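(* The category $\mathbf{MetCH_{sep,sym}}$ is Barr-coexact, i.e. its opposite category is Barr-exact.
   Context: A metric on a set $X$ is a map $d\colon X\times X\to[0,\infty]$ with $d(x,x)=0$ and $d(x,z)\le d(x,y)+d(y,z)$ ($\infty$ allowed); separated means $d(x,y)=0=d(y,x)$ implies $x=y$; symmetric means $d(x,y)=d(y,x)$. A separated metric compact Hausdorff space is a compact Hausdorff space with a separated metric continuous $X\times X\to[0,\infty]$ for the upper topology on $[0,\infty]$ (open sets $]u,\infty]$). $\mathbf{MetCH_{sep,sym}}$ is the category of separated metric compact Hausdorff spaces whose metric is symmetric, with continuous non-expansive maps ($d_Y(f(x),f(y))\le d_X(x,y)$). A category is regular if it is finitely complete, has coequalisers of kernel pairs, and regular epimorphisms are pullback-stable; Barr-exact if it is regular and every internal equivalence relation is effective (a kernel pair). *)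

(* Defs.v *)
From HB Require Import structures.
From mathcomp Require Import all_boot all_order all_algebra.
From mathcomp Require Import all_classical all_reals topology.
Set Implicit Arguments. Unset Strict Implicit. Unset Printing Implicit Defensive.
Import Order.TTheory GRing.Theory Num.Theory.
Local Open Scope classical_set_scope.
Local Open Scope ereal_scope.

(* A minimal notion of category (data only: the laws are not needed to *)
(* state the exactness properties below).                               *)
Record category := Category {
  ob : Type;
  hom : ob -> ob -> Type;
  comp : forall a b c : ob, hom b c -> hom a b -> hom a c;
  idm : forall a : ob, hom a a }.

Arguments comp {c a b c0} g f : rename.
Arguments idm {c} a : rename.
Notation "g \oc f" := (comp g f) (at level 40, left associativity).

Definition op (C : category) : category :=
  @Category (ob C) (fun a b => hom b a)
    (fun a b c (g : hom c b) (f : hom b a) => @comp C c b a f g)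
    (fun a => idm a).

Section CatNotions.
Variable C : category.
Local Notation ob := (ob C).
Local Notation hom := (@hom C).

Definition is_terminal (t : ob) :=
  forall x : ob, exists f : hom x t, forall g : hom x t, g = f.

Definition is_product (a b p : ob) (p1 : hom p a) (p2 : hom p b) :=
  forall (x : ob) (f : hom x a) (g : hom x b),
    exists! h : hom x p, p1 \oc h = f /\ p2 \oc h = g.

Definition is_equalizer (a b e : ob) (f g : hom a b) (m : hom e a) :=
  f \oc m = g \oc m /\
  forall (x : ob) (h : hom x a), f \oc h = g \oc h ->
    exists! u : hom x e, m \oc u = h.

Definition is_coequalizer (a b q : ob) (f g : hom a b) (m : hom b q) :=
  m \oc f = m \oc g /\
  forall (x : ob) (h : hom b x), h \oc f = h \oc g ->
    exists! u : hom q x, u \oc m = h.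

Definition is_pullback (a b c p : ob) (f : hom a c) (g : hom b c)
    (p1 : hom p a) (p2 : hom p b) :=
  f \oc p1 = g \oc p2 /\
  forall (x : ob) (u : hom x a) (v : hom x b), f \oc u = g \oc v ->
    exists! h : hom x p, p1 \oc h = u /\ p2 \oc h = v.

Definition is_kernel_pair (a b r : ob) (f : hom a b) (r1 r2 : hom r a) :=
  is_pullback f f r1 r2.

Definition finitely_complete :=
  (exists t : ob, is_terminal t) /\
  (forall a b : ob, exists p (p1 : hom p a) (p2 : hom p b), is_product p1 p2) /\
  (forall (a b : ob) (f g : hom a b), exists e (m : hom e a), is_equalizer f g m).

Definition has_coequalizers_of_kernel_pairs :=
  forall (a b r : ob) (f : hom a b) (r1 r2 : hom r a),
    is_kernel_pair f r1 r2 -> exists q (m : hom a q), is_coequalizer r1 r2 m.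

Definition regular_epi (b q : ob) (m : hom b q) :=
  exists a (f g : hom a b), is_coequalizer f g m.

Definition regular_epis_pullback_stable :=
  forall (a b c p : ob) (f : hom a c) (g : hom b c) (p1 : hom p a) (p2 : hom p b),
    is_pullback f g p1 p2 -> regular_epi f -> regular_epi p2.

Definition regular_category :=
  [/\ finitely_complete, has_coequalizers_of_kernel_pairs
    & regular_epis_pullback_stable].

Definition jointly_monic (a r : ob) (r1 r2 : hom r a) :=
  forall (x : ob) (u v : hom x r), r1 \oc u = r1 \oc v -> r2 \oc u = r2 \oc v -> u = v.

Definition internal_equivalence_relation (a r : ob) (r1 r2 : hom r a) :=
  [/\ jointly_monic r1 r2,
      exists d : hom a r, r1 \oc d = idm a /\ r2 \oc d = idm a,
      exists s : hom r r, r1 \oc s = r2 /\ r2 \oc s = r1 &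
      forall (p : ob) (q1 q2 : hom p r), is_pullback r2 r1 q1 q2 ->
        exists t : hom p r, r1 \oc t = r1 \oc q1 /\ r2 \oc t = r2 \oc q2].

Definition effective (a r : ob) (r1 r2 : hom r a) :=
  exists b (f : hom a b), is_kernel_pair f r1 r2.

Definition barr_exact :=
  regular_category /\
  forall (a r : ob) (r1 r2 : hom r a),
    internal_equivalence_relation r1 r2 -> effective r1 r2.

End CatNotions.

Definition barr_coexact (C : category) := barr_exact (op C).

Section MetCH.
Variable R : realType.

Record metCH := MetCH {
  mc_car :> topologicalType;
  mc_d : mc_car -> mc_car -> \bar R;
  mc_compact : compact [set: mc_car];
  mc_hausdorff : hausdorff_space mc_car;
  mc_d_ge0 : forall x y, 0 <= mc_d x y;
  mc_d_refl : forall x, mc_d x x = 0;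
  mc_d_tri : forall x y z, mc_d x z <= mc_d x y + mc_d y z;
  mc_d_sep : forall x y, mc_d x y = 0 -> mc_d y x = 0 -> x = y;
  mc_d_sym : forall x y, mc_d x y = mc_d y x;
  (* continuity of d : X x X -> [0,oo] for the upper topology, whose open *)
  (* sets are ]u, oo] (and the whole space) *)
  mc_d_cont : forall u : \bar R, open [set p : mc_car * mc_car | u < mc_d p.1 p.2] }.

Record mhom (X Y : metCH) := MHom {
  mfun :> X -> Y;
  mfun_cont : continuous mfun;
  mfun_nonexp : forall x y, mc_d (mfun x) (mfun y) <= mc_d x y }.

Arguments mfun_cont [X Y] m : rename.
Lemma mhom_comp_cont (X Y Z : metCH) (g : mhom Y Z) (f : mhom X Y) :
  continuous (g \o f).
Proof.
have cf := mfun_cont f; have cg := mfun_cont g.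
move=> x; apply: continuous_comp; [exact: cf | exact: cg].
Qed.

Lemma mhom_comp_nonexp (X Y Z : metCH) (g : mhom Y Z) (f : mhom X Y) :
  forall x y, mc_d ((g \o f) x) ((g \o f) y) <= mc_d x y.
Proof.
move=> x y /=; apply: le_trans (mfun_nonexp g _ _) (mfun_nonexp f _ _).
Qed.

Definition mhom_comp (X Y Z : metCH) (g : mhom Y Z) (f : mhom X Y) : mhom X Z :=
  @MHom X Z (g \o f) (@mhom_comp_cont X Y Z g f) (@mhom_comp_nonexp X Y Z g f).

Lemma mhom_id_cont (X : metCH) : continuous (@id X).
Proof. by move=> x; apply: cvg_id. Qed.

Lemma mhom_id_nonexp (X : metCH) : forall x y : X, mc_d (id x) (id y) <= mc_d x y.
Proof. by []. Qed.

Definition mhom_id (X : metCH) : mhom X X :=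
  @MHom X X id (@mhom_id_cont X) (@mhom_id_nonexp X).

Definition MetCH_sep_sym : category :=
  @Category metCH mhom mhom_comp mhom_id.

End MetCH.

(* Main.v *)
Require Import Defs.
From mathcomp Require Import all_boot all_order all_algebra.
From mathcomp Require Import all_classical all_reals topology ereal.
From mathcomp Require Import lra.
Set Implicit Arguments. Unset Strict Implicit. Unset Printing Implicit Defensive.
Import Order.TTheory GRing.Theory Num.Theory.
Local Open Scope classical_set_scope.
Local Open Scope ereal_scope.

(** Quotients of a space X correspond to lower semicontinuous pseudometrics
    below d_X. The supremum of those identifying f with g gives the coequaliser.
    An embedding K -> S together with such a pseudometric delta on K has a
    largest extension to S,
    d(s, s') = min (d_S(s, s'), inf_(k, k') d_S(s, k) + delta(k, k') + d_S(k', s')),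
    where the infimum is attained by compactness; this amalgamates an isometric
    A -> B with any A -> C without changing the metric of C. Hence the
    equalisers are exactly the isometric maps, they are stable under pushout, and
    epimorphisms are surjective.
    An equivalence relation in the opposite category is a pair r1, r2 : B -> E
    with a common retraction. The cotransitivity map and the amalgam formula show
    that rho(x, y) = d_E(r1 x, r2 y) has midpoints, and minimising rho along paths
    of length at most rho(x, y) shows that every finite rho(x, y) is realised by
    a path through the equaliser of r1 and r2. So E is the cokernel pair of that
    equaliser. *)

(** * Lower semicontinuous functions with values in the extended reals *)

Section LowerSemicontinuity.
Variable R : realType.
Implicit Types T X K : topologicalType.

Lemma ereal_between (x y : \bar R) : x < y -> exists z, x < z < y.
Proof.
case: x y => [a| |] [b| |] //.
- rewrite lte_fin => ab; exists ((a + b) / 2)%:E; rewrite !lte_fin.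
  by apply/andP; split; lra.
- by move=> _; exists (a + 1)%:E; rewrite lte_fin ltry andbT; lra.
- by move=> _; exists (b - 1)%:E; rewrite lte_fin ltNyr /=; lra.
- by move=> _; exists 0; rewrite ltNyr ltry.
Qed.

(** Continuity for the upper topology, with thresholds [u] ranging over all of [\bar R] as in
    [mc_d_cont]. *)
Definition lsc T (F : T -> \bar R) := forall u, open [set x | u < F x].

Lemma lsc_closed_le T (F : T -> \bar R) u : lsc F -> closed [set x | F x <= u].
Proof.
move=> /(_ u) lF; rewrite (_ : [set _ | _] = ~` [set x | u < F x]).
  exact: open_closedC.
by apply/seteqP; split => x /=; rewrite leNgt => /negP.
Qed.

Lemma lsc_comp T T' (f : T' -> T) (F : T -> \bar R) :
  lsc F -> continuous f -> lsc (F \o f).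
Proof. by move=> lF cf u; apply: open_comp (lF u) => x _; exact: cf. Qed.

Lemma lsc_near T (F : T -> \bar R) x u : lsc F -> u < F x -> \near x, u < F x.
Proof. by move=> lF uF; apply: (open_nbhs_nbhs (A := [set y | u < F y])). Qed.

Lemma lsc_add T (F G : T -> \bar R) : (forall x, 0 <= F x) -> (forall x, 0 <= G x) ->
  lsc F -> lsc G -> lsc (fun x => F x + G x).
Proof.
move=> F0 G0 lF lG u; rewrite openE /interior => x /= uFG.
(* The strict inequality is split between the two summands; when all values are finite, each takes
   half of the slack. *)
have [s [t [sF tG ust]]] : exists s t, [/\ s < F x, t < G x & u <= s + t].
  move: (F0 x) (G0 x) uFG; case: (F x) (G x) u => [a| |] [b| |] [c| |] //= _ _.
  - rewrite !lte_fin => cab.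
    exists (a - (a + b - c) / 2)%:E, (b - (a + b - c) / 2)%:E.
    by rewrite !lte_fin -EFinD lee_fin; split; lra.
  - by move=> _; exists -oo, -oo; rewrite !ltNyr.
  - move=> _; exists (a - 1)%:E, (c - a + 1)%:E.
    by rewrite ltry lte_fin -EFinD lee_fin; split => //; lra.
  - by move=> _; exists -oo, -oo; rewrite ltNyr.
  - move=> _; exists (c - b + 1)%:E, (b - 1)%:E.
    by rewrite ltry lte_fin -EFinD lee_fin; split => //; lra.
  - by move=> _; exists -oo, -oo; rewrite ltNyr.
  - by move=> _; exists c%:E, 0; rewrite !ltry adde0.
  - by move=> _; exists -oo, -oo.
near=> y; apply: le_lt_trans ust _.
by apply: lteD; near: y; exact: lsc_near.
Unshelve. all: by end_near. Qed.

Lemma lsc_min T (F G : T -> \bar R) :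
  lsc F -> lsc G -> lsc (fun x => mine (F x) (G x)).
Proof.
move=> lF lG u; rewrite (_ : [set _ | _] = [set x | u < F x] `&` [set x | u < G x]).
  exact: openI.
by apply/seteqP; split => x /=; rewrite lt_min => /andP.
Qed.

Lemma lsc_sup I T (D : set I) (F : I -> T -> \bar R) :
  (forall i, D i -> lsc (F i)) -> lsc (fun x => ereal_sup [set F i x | i in D]).
Proof.
move=> lF u.
rewrite (_ : [set _ | _] = \bigcup_(i in D) [set x | u < F i x]).
  by apply: bigcup_open => i Di; exact: lF.
apply/seteqP; split => x /=.
  by move=> /ereal_sup_gt[_ [i Di <-]]; exists i.
move=> [i Di] /= /lt_le_trans; apply; apply: ereal_sup_ubound; by exists i.
Qed.

(** If a value [i] below [+oo] is not attained, each point of [A] has a neighbourhood on which [F]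
    exceeds some [v > i]. Compactness makes one [v] work on all of [A], so the infimum would be at
    least [v]. The alternative [+oo] includes the case of an empty [A]. *)
Lemma lsc_inf_attained K (A : set K) (F : K -> \bar R) : compact A -> lsc F ->
  ereal_inf (F @` A) = +oo \/ exists2 k, A k & ereal_inf (F @` A) = F k.
Proof.
move=> cA lF; set i := ereal_inf _.
have [->|iNy] := eqVneq i +oo; first by left.
right; apply: contrapT => noK.
have iF k : A k -> i < F k.
  move=> Ak; rewrite lt_neqAle ereal_inf_lbound ?andbT; last by exists k.
  by apply/eqP => ik; apply: noK; exists k.
(* The filter of values descending to [i]: a property holding near it holds for all values up to
   some [v > i]. *)
pose Fi := filter_from [set v | i < v] (fun v => [set w | w <= v]).
have FF : Filter Fi.
  apply: filter_from_filter; first by exists +oo; rewrite /= ltey.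
  move=> v w iv iw; exists (mine v w); first by rewrite /= lt_min iv.
  by move=> z /=; rewrite le_min => /andP.
have /compact_near_coveringP/(_ _ Fi (fun w k => w < F k) FF) := cA.
case.
  move=> k Ak; have [v /andP[iv vF]] := ereal_between (iF k Ak).
  exists ([set x | v < F x], [set w | w <= v]) => /=.
    by split; [exact: lsc_near|exists v].
  by move=> [x w] /= [vx wv]; exact: le_lt_trans vx.
move=> v iv /(_ v (lexx _)) vF.
suff : v <= i by rewrite leNgt iv.
by apply: le_ereal_inf_tmp => _ [k Ak <-]; exact/ltW/vF.
Qed.

(** A tube argument: if [F x] exceeds [u] on the compact [K], so does [F y] for all [y] near [x].
    Attainment of the infimum then keeps the inequality strict. *)
Lemma lsc_inf T K (F : T -> K -> \bar R) : compact [set: K] ->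
  lsc (fun p : T * K => F p.1 p.2) ->
  lsc (fun x => ereal_inf (range (F x))).
Proof.
move=> cK lF u; rewrite openE /interior => x /= uF.
have lFx y : lsc (F y).
  apply: (lsc_comp (f := fun k => (y, k)) lF) => k.
  by apply: cvg_pair; [exact: cvg_cst|exact: cvg_id].
have h (k : K) : setT k -> \forall k' \near k & i \near nbhs x, u < F i k'.
  move=> _; have : nbhs ((x, k) : (T * K)%type) [set p : (T * K)%type | u < F p.1 p.2].
    apply: open_nbhs_nbhs; split; first exact: lF.
    by apply: lt_le_trans uF _; apply: ereal_inf_lbound; exists k.
  move=> [[A B] /= [nA nB] AB]; exists (B, A) => //= -[k' y] /= [Bk Ay].
  exact: (AB (y, k')).
have := (compact_near_coveringP _).1 cK _ (nbhs x) (fun y k => u < F y k) _ h.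
move=> /(_ (nbhs_filter x)) uF_near; near=> y.
have uy : [set: K] `<=` (fun k => u < F y k) by near: y; exact: uF_near.
rewrite /=.
have [->|[k _ ->]] := lsc_inf_attained cK (lFx y); last exact: uy.
by apply: lt_le_trans uF _; exact: leey.
Unshelve. all: by end_near.
Qed.

End LowerSemicontinuity.

(** * Continuity into products, and closed maps between compact Hausdorff spaces *)

Lemma continuous_pair (T U V : topologicalType) (f : T -> U) (g : T -> V) :
  continuous f -> continuous g -> continuous (fun x => (f x, g x)).
Proof. by move=> cf cg x; apply: cvg_pair; [exact: cf|exact: cg]. Qed.

Lemma continuous_compose (T U V : topologicalType) (g : U -> V) (f : T -> U) :
  continuous g -> continuous f -> continuous (fun x => g (f x)).
Proof. by move=> cg cf x; apply: continuous_comp; [exact: cf|exact: cg]. Qed.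

Lemma continuous_fst (U V : topologicalType) : continuous (@fst U V).
Proof. by move=> x; exact: cvg_fst. Qed.

Lemma continuous_snd (U V : topologicalType) : continuous (@snd U V).
Proof. by move=> x; exact: cvg_snd. Qed.

Lemma hausdorff_prod (U V : topologicalType) :
  hausdorff_space U -> hausdorff_space V -> hausdorff_space (U * V)%type.
Proof.
move=> hU hV [a b] [a' b'] ab; congr pair.
- apply: hU => A B nA nB; have [] := ab (A `*` setT) (B `*` setT).
  + by exists (A, setT) => //=; split => //; exact: filterT.
  + by exists (B, setT) => //=; split => //; exact: filterT.
  + by move=> -[x y] [[/= Ax _] [/= Bx _]]; exists x.
- apply: hV => A B nA nB; have [] := ab (setT `*` A) (setT `*` B).
  + by exists (setT, A) => //=; split => //; exact: filterT.
  + by exists (setT, B) => //=; split => //; exact: filterT.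
  + by move=> -[x y] [[/= _ Ay] [/= _ By]]; exists y.
Qed.

Lemma closed_image (X Y : topologicalType) (f : X -> Y) (K : set X) :
  compact [set: X] -> hausdorff_space Y -> continuous f -> closed K ->
  closed (f @` K).
Proof.
move=> cX hY cf clK; apply: compact_closed => //; apply: continuous_compact.
  exact/continuous_subspaceT.
exact: subclosed_compact clK cX _.
Qed.

(** * Pseudometrics, the quotients they define, and closed subspaces *)

Section Pseudometrics.
Variable R : realType.

Definition lsc_pseudometric (X : topologicalType) (d : X -> X -> \bar R) :=
  [/\ forall x y, 0 <= d x y, forall x, d x x = 0,
      forall x y z, d x z <= d x y + d y z, forall x y, d x y = d y x
    & lsc (fun p : X * X => d p.1 p.2)].

Lemma lsc_pseudometric_comp (X Y : topologicalType) (f : X -> Y) d :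
  lsc_pseudometric d -> continuous f -> lsc_pseudometric (fun x y => d (f x) (f y)).
Proof.
move=> [d0 dxx dtri dsym dl] cf; split=> //.
apply: (lsc_comp (f := fun p : X * X => (f p.1, f p.2)) dl).
apply: continuous_pair; apply: (continuous_compose cf).
  exact: continuous_fst.
exact: continuous_snd.
Qed.

Lemma mc_lsc_pseudometric (X : metCH R) : lsc_pseudometric (@mc_d R X).
Proof.
by split; [exact: mc_d_ge0|exact: mc_d_refl|exact: mc_d_tri|exact: mc_d_sym
  |exact: mc_d_cont].
Qed.

Section Quotient.
Variables (X : topologicalType) (cX : compact [set: X]) (hX : hausdorff_space X).
Variables (d : X -> X -> \bar R) (pd : lsc_pseudometric d).

Let d_ge0 x y : 0 <= d x y. Proof. by case: pd. Qed.
Let d_refl x : d x x = 0. Proof. by case: pd. Qed.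
Let d_tri x y z : d x z <= d x y + d y z. Proof. by case: pd. Qed.
Let d_sym x y : d x y = d y x. Proof. by case: pd. Qed.
Let d_lsc : lsc (fun p : X * X => d p.1 p.2). Proof. by case: pd. Qed.

Let d0_le x y z : d x y = 0 -> d x z <= d y z.
Proof. by move=> xy; rewrite -[leRHS]add0e -xy. Qed.

Let d0_eq x y z : d x y = 0 -> d x z = d y z.
Proof. by move=> xy; apply/le_anti; rewrite !d0_le // d_sym. Qed.

Local Open Scope quotient_scope.
Let E x y := d x y == 0.
Let E_refl : reflexive E. Proof. by move=> x; rewrite /E d_refl. Qed.
Let E_sym : symmetric E. Proof. by move=> x y; rewrite /E d_sym. Qed.
Let E_trans : transitive E.
Proof. by move=> y x z /eqP xy /eqP yz; rewrite /E (d0_eq _ xy) yz. Qed.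

Definition zero_distance := EquivRel E E_refl E_sym E_trans.

Let Q : topologicalType := quotient_topology {eq_quot zero_distance}%qT.
Let q : X -> Q := \pi_({eq_quot zero_distance})%qT.

Let q_eq x y : q x = q y <-> d x y = 0.
Proof.
rewrite /q; split.
  by move=> /eqquotP/eqP.
by move=> xy; apply/eqquotP/eqP.
Qed.

Let q_surj p : exists x, q x = p.
Proof. by exists (repr (p : {eq_quot zero_distance})); rewrite /q reprK. Qed.

Let q_cont : continuous q. Proof. exact: pi_continuous. Qed.

Let saturation (K : set X) := [set y | exists2 x, K x & d x y = 0].

(** The saturation is the projection of a closed subset of the compact square, and this projection
    is a closed map. *)
Let closed_saturation K : closed K -> closed (saturation K).
Proof.
move=> clK.
have -> : saturation K = snd @` ((fst @^-1` K) `&` [set p : X * X | d p.1 p.2 <= 0]).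
  apply/seteqP; split => y /=.
    by move=> [x Kx xy]; exists (x, y) => //=; rewrite xy.
  by move=> [[x z] /= [Kx xz] <-]; exists x => //; apply/le_anti; rewrite xz d_ge0.
apply: closed_image => //.
- by rewrite -setXTT; exact: compact_setX.
- exact: continuous_snd.
apply: closedI; last exact: lsc_closed_le.
by apply: preimage_closed clK => x _; exact: continuous_fst.
Qed.

(** Classes are closed and a compact Hausdorff space is normal, so two classes have disjoint open
    neighbourhoods; these are then shrunk to saturated ones. *)
Let q_hausdorff : hausdorff_space Q.
Proof.
move=> p p'; have [x <-] := q_surj p; have [y <-] := q_surj p' => qq.
apply: contrapT => qxy.
have class_closed z : closed (saturation [set z]).
  by apply: closed_saturation; apply: compact_closed => //; exact: compact_set1.
(* Normality gives a neighbourhood [C] of the class of [x] whose closure misses the class of [y]. An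
   open [U] inside [C] and the complement [V] of the closure separate the classes. *)
have [] := @compact_normal _ hX cX (saturation [set x]) (class_closed x)
  (~` saturation [set y]).
  apply/set_nbhsP; exists (~` saturation [set y]); split => //.
    exact: closed_openC.
  move=> z [_ -> xz] [_ -> yz]; apply/qxy/q_eq.
  by rewrite d_sym in yz; rewrite (d0_eq _ xz).
move=> C /set_nbhsP[U [oU xU UC]] CN.
pose V := ~` closure C.
have oV : open V by apply: closed_openC; exact: closed_closure.
have yV : saturation [set y] `<=` V by move=> z yz /CN.
have UV z : U z -> V z -> False by move=> /UC Uz; apply; exact: subset_closure.
(* [W A] consists of the classes contained in [A]; for open [A] its preimage is the complement of
   the saturation of a closed set. *)
pose W (A : set X) : set Q := ~` (q @` ~` A).
have WE A : q @^-1` (W A) = ~` saturation (~` A).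
  apply/seteqP; split => z /= nz [t At] tz; apply: nz.
    by exists t => //; apply/q_eq.
  by exists t => //; apply/q_eq.
have oW A : open A -> open (W A).
  move=> oA; rewrite /open/= /quotient_open.
  have := WE A; rewrite /q => ->.
  by apply: closed_openC; apply: closed_saturation; exact: open_closedC.
have WI A z : saturation [set z] `<=` A -> W A (q z).
  move=> zA [t At] /q_eq tz; apply: At; apply: zA; exists z => //.
  by rewrite d_sym.
have [||r []] := qq (W U) (W V).
- by apply: open_nbhs_nbhs; split; [exact: oW|exact: WI].
- by apply: open_nbhs_nbhs; split; [exact: oW|exact: WI].
have [z <-] := q_surj r => Uz Vz.
by apply: (@UV z); apply: contrapT => nz; [apply: Uz|apply: Vz]; exists z.
Qed.

Lemma quotient_metCH : exists (Q : metCH R) (q : X -> Q),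
  [/\ continuous q, forall p, exists x, q x = p
    & forall x y, mc_d (q x) (q y) = d x y].
Proof.
pose dQ (p p' : Q) :=
  d (repr (p : {eq_quot zero_distance})) (repr (p' : {eq_quot zero_distance})).
have dQE x y : dQ (q x) (q y) = d x y.
  have rE z : d (repr (q z : {eq_quot zero_distance})) z = 0.
    by apply/q_eq; rewrite /q reprK.
  by rewrite /dQ (d0_eq _ (rE x)) d_sym (d0_eq _ (rE y)) d_sym.
have cQ : compact [set: Q].
  have -> : [set: Q] = q @` setT.
    by apply/seteqP; split => p //= _; have [x <-] := q_surj p; exists x.
  by apply: continuous_compact => //; exact/continuous_subspaceT.
(* Sublevel sets of [dQ] are images of sublevel sets of [d] under the closed map [q] x [q]. *)
have dQ_lsc u : open [set p : Q * Q | u < dQ p.1 p.2].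
  pose qq (p : X * X) := (q p.1, q p.2).
  have -> : [set p : Q * Q | u < dQ p.1 p.2] =
      ~` (qq @` [set p | d p.1 p.2 <= u]).
    apply/seteqP; split => -[p p'] /=.
      by rewrite ltNge => /negP up [[x y] /= xy [xp yp]]; apply: up; rewrite -xp -yp dQE.
    have [x <-] := q_surj p; have [y <-] := q_surj p'; rewrite dQE => h.
    by rewrite ltNge; apply/negP => xy; apply: h; exists (x, y).
  apply: closed_openC; apply: closed_image.
  - by rewrite -setXTT; exact: compact_setX.
  - exact: hausdorff_prod.
  - apply: continuous_pair; apply: (continuous_compose q_cont).
      exact: continuous_fst.
    exact: continuous_snd.
  - exact: lsc_closed_le.
have dQ_sep (p p' : Q) : dQ p p' = 0 -> dQ p' p = 0 -> p = p'.
  by have [x <-] := q_surj p; have [y <-] := q_surj p'; rewrite dQE => /q_eq.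
exists (@MetCH R Q dQ cQ q_hausdorff (fun _ _ => d_ge0 _ _) (fun _ => d_refl _)
  (fun _ _ _ => d_tri _ _ _) dQ_sep (fun _ _ => d_sym _ _) dQ_lsc), q.
by split.
Qed.

End Quotient.

(** The subset type carries the topology induced by the inclusion. It is compact because a filter on
    it, pushed forward to [X], clusters at a point of the closed set [A]. *)
Lemma closed_subspace (X : metCH R) (A : set X) : closed A ->
  exists (S : metCH R) (m : mhom S X),
    (forall x y, mc_d (m x) (m y) = mc_d x y) /\ range m = A.
Proof.
move=> clA; pose S : topologicalType := set_type A.
pose m : S -> X := set_val.
have cm : continuous m by exact: initial_continuous.
have rm : range m = A.
  apply/seteqP; split => x /=; first by move=> [[y Ay] _ <-]; exact: set_mem.
  by move=> Ax; exists (exist _ x (mem_set Ax)).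
have cS : compact [set: S].
  move=> F FF _.
  have FA : F (m @^-1` A) by apply: filterE => -[y Ay]; exact: set_mem.
  have [x [Ax xF]] :=
    subclosed_compact clA (@mc_compact R X) (fun _ _ => I) (fmap_proper_filter m FF) FA.
  exists (exist _ x (mem_set Ax)); split=> // U V FU.
  rewrite nbhsE => -[W [[W' oW' <-] /= xW'] WV].
  have [||y [[s Us <-] Wy]] := xF (m @` U) W'.
  - by change (F (m @^-1` (m @` U))); apply: filterS FU => s Us; exists s.
  - by apply: open_nbhs_nbhs.
  - by exists s; split => //; apply: WV.
have hS : hausdorff_space S.
  move=> s t st; apply: val_inj; apply: (@mc_hausdorff R X) => U V nU nV.
  have [||z [Uz Vz]] := st (m @^-1` U) (m @^-1` V); try exact: cm.
  by exists (m z).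
have [d0 dxx dtri dsym dl] := lsc_pseudometric_comp (mc_lsc_pseudometric X) cm.
have dsep (x y : S) : mc_d (m x) (m y) = 0 -> mc_d (m y) (m x) = 0 -> x = y.
  by move=> xy yx; apply: val_inj; exact: mc_d_sep xy yx.
pose SM := @MetCH R S (fun x y => mc_d (m x) (m y)) cS hS d0 dxx dtri dsep dsym dl.
by exists SM, (@MHom R SM X m cm (fun x y => lexx _)).
Qed.

End Pseudometrics.

(** * Finite coproducts *)

Section Coproduct.
Variables (R : realType) (I : finType) (F : I -> metCH R).

Let T : topologicalType := {i & F i}.
Let dT (u v : T) : \bar R :=
  if tag u == tag v then mc_d (tagged u) (tagged_as u v) else +oo.

Let dT_same i (x y : F i) : dT (Tagged F x) (Tagged F y) = mc_d x y.
Proof. by rewrite /dT /= eqxx tagged_asE. Qed.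

Let dT_diff i j (x : F i) (y : F j) : i != j -> dT (Tagged F x) (Tagged F y) = +oo.
Proof. by rewrite /dT /= => /negbTE ->. Qed.

(** For lower semicontinuity: summands are open, so every pair has a neighbourhood on which [dT] is
    either the metric of one summand or constantly [+oo]. *)
Let dT_pseudometric : lsc_pseudometric dT.
Proof.
split.
- move=> [i x] [j y]; case: (eqVneq i j) => [ij|ij]; last by rewrite dT_diff.
  by subst j; rewrite dT_same; exact: mc_d_ge0.
- by move=> [i x]; rewrite dT_same mc_d_refl.
- move=> [i x] [j y] [k z].
  case: (eqVneq i j) => [ij|ij]; last first.
    rewrite (dT_diff _ _ ij) addye ?leey//.
    case: (eqVneq j k) => [jk|jk]; last by rewrite dT_diff.
    by subst k; rewrite dT_same gt_eqF // (lt_le_trans ltNy0) // mc_d_ge0.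
  subst j; rewrite dT_same; case: (eqVneq i k) => [ik|ik].
    by subst k; rewrite !dT_same; exact: mc_d_tri.
  rewrite !dT_diff // addey ?leey //.
  by rewrite gt_eqF // (lt_le_trans ltNy0) // mc_d_ge0.
- move=> [i x] [j y]; case: (eqVneq i j) => [ij|ij].
    by subst j; rewrite !dT_same; exact: mc_d_sym.
  by rewrite !dT_diff // eq_sym.
- move=> u; rewrite openE /interior => -[[i x] [j y]] /=.
  case: (eqVneq i j) => [ij|ij]; last first.
    rewrite dT_diff // => uy.
    exists (existT F i @` setT, existT F j @` setT).
      by split; apply: existT_nbhs; exact: filterT.
    by move=> [_ _] [/= [x' _ <-] [y' _ <-]]; rewrite /= dT_diff.
  subst j; rewrite dT_same => uxy.
  have [[A B] /= [nA nB] AB] : nbhs ((x, y) : (F i * F i)%type)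
      [set p : (F i * F i)%type | u < mc_d p.1 p.2].
    by apply: open_nbhs_nbhs; split; [exact: mc_d_cont|].
  exists (existT F i @` A, existT F i @` B); first by split; exact: existT_nbhs.
  move=> [_ _] [/= [x' Ax <-] [y' By <-]]; rewrite /= dT_same.
  exact: (AB (x', y')).
Qed.

(** An arbitrary finite index type serves both the initial object (indexed by [void]) and binary
    coproducts (indexed by [bool]). *)
Lemma finite_coproduct : exists (S : metCH R) (inj : forall i, mhom (F i) S),
  [/\ forall s, exists i x, s = inj i x,
      forall i (x y : F i), mc_d (inj i x) (inj i y) = mc_d x y,
      forall i j (x : F i) (y : F j), i != j -> mc_d (inj i x) (inj j y) = +oo
    & forall (Z : metCH R) (f : forall i, mhom (F i) Z),
        exists h : mhom S Z, forall i x, h (inj i x) = f i x].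
Proof.
have cT : compact [set: T].
  by apply: sigT_compact; [exact: finite_finset|move=> i; exact: mc_compact].
have hT : hausdorff_space T by apply: sigT_hausdorff => i; exact: mc_hausdorff.
have [d0 dxx dtri dsym dl] := dT_pseudometric.
have dsep (u v : T) : dT u v = 0 -> dT v u = 0 -> u = v.
  case: u v => [i x] [j y]; case: (eqVneq i j) => [ij|ij]; last by rewrite dT_diff.
  by subst j; rewrite !dT_same => xy yx; rewrite (mc_d_sep xy yx).
pose S := @MetCH R T dT cT hT d0 dxx dtri dsep dsym dl.
have inj_nonexp i (x y : F i) : dT (existT F i x) (existT F i y) <= mc_d x y.
  by rewrite dT_same.
exists S, (fun i => @MHom R (F i) S (existT F i) (@existT_continuous _ _ i)
  (@inj_nonexp i)); split => /=.
- by move=> [i x]; exists i, x.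
- by move=> i x y; rewrite dT_same.
- by move=> i j x y ij; rewrite dT_diff.
move=> Z f.
have ch : continuous (fun u : T => f (tag u) (tagged u)).
  by apply: (@sigT_continuous _ _ _ (fun i => mfun (f i))) => i; exact: mfun_cont.
have nh (u v : T) : mc_d (f (tag u) (tagged u))
    (f (tag v) (tagged v)) <= dT u v.
  case: u v => [i x] [j y]; case: (eqVneq i j) => [ij|ij].
    by subst j; rewrite dT_same; exact: mfun_nonexp.
  by rewrite dT_diff // leey.
by exists (@MHom R S Z _ ch nh).
Qed.

End Coproduct.

(** * Isometric and surjective morphisms, factorisations, coequalisers *)

Section Morphisms.
Variable R : realType.
Implicit Types X Y Z S Q : metCH R.

Definition isometric X Y (m : mhom X Y) := forall x y, mc_d (m x) (m y) = mc_d x y.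

Definition surjective X Y (q : mhom X Y) := forall y, exists x, q x = y.

Lemma mhom_ext X Y (f g : mhom X Y) : f =1 g -> f = g.
Proof.
case: f g => [f cf nf] [g cg ng] /= /funext fg; subst g.
by rewrite (Prop_irrelevance cf cg) (Prop_irrelevance nf ng).
Qed.

Lemma mhom_eqE X Y (f g : mhom X Y) : f = g -> f =1 g.
Proof. by move=> ->. Qed.

Lemma mc_d_eq0 X (x y : X) : mc_d x y <= 0 -> x = y.
Proof.
move=> xy; have xy0 : mc_d x y = 0 by apply/le_anti; rewrite xy mc_d_ge0.
by apply: mc_d_sep; rewrite // mc_d_sym.
Qed.

Lemma isometric_inj X Y (m : mhom X Y) : isometric m -> injective m.
Proof. by move=> im x y xy; apply: mc_d_eq0; rewrite -im xy mc_d_refl. Qed.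

Lemma binary_coproduct X Y : exists S (i1 : mhom X S) (i2 : mhom Y S),
  [/\ forall s, (exists x, s = i1 x) \/ (exists y, s = i2 y),
      isometric i1, isometric i2, forall x y, mc_d (i1 x) (i2 y) = +oo
    & forall Z (f : mhom X Z) (g : mhom Y Z), exists h : mhom S Z,
        (forall x, h (i1 x) = f x) /\ (forall y, h (i2 y) = g y)].
Proof.
pose F b := if b then X else Y.
have [S [inj [surj iso far copair]]] := finite_coproduct F.
exists S, (inj true), (inj false); split.
- by move=> s; have [[] [x ->]] := surj s; [left|right]; exists x.
- exact: (iso true).
- exact: (iso false).
- by move=> x y; apply: (far true false).
move=> Z f g.
have [h hE] := copair Z (fun b => match b return mhom (F b) Z with
  | true => f | false => g end).
by exists h; split => x; [exact: (hE true)|exact: (hE false)].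
Qed.

(* The continuous surjection q is a closed map, hence a topological quotient. *)
Lemma factor_surjective X Q Z (q : mhom X Q) (f : mhom X Z) : surjective q ->
  (forall x y, mc_d (f x) (f y) <= mc_d (q x) (q y)) ->
  exists h : mhom Q Z, forall x, h (q x) = f x.
Proof.
move=> sq fq; pose h p := f (sval (cid (sq p))).
have hq x : h (q x) = f x.
  rewrite /h; case: cid => y /= yx; apply: mc_d_eq0.
  by apply: le_trans (fq _ _) _; rewrite yx mc_d_refl.
have ch : continuous h.
  apply/continuous_closedP => K clK.
  have -> : h @^-1` K = q @` (f @^-1` K).
    apply/seteqP; split => p /=.
      by have [x <-] := sq p; rewrite hq; exists x.
    by move=> [x Kx <-]; rewrite hq.
  apply: closed_image; [exact: mc_compact|exact: mc_hausdorff|exact: mfun_cont|].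
  by move/continuous_closedP: (@mfun_cont _ _ _ f); apply.
have nh p p' : mc_d (h p) (h p') <= mc_d p p'.
  by have [x <-] := sq p; have [y <-] := sq p'; rewrite !hq.
by exists (@MHom R Q Z h ch nh).
Qed.

Lemma quotient_mhom X (d : X -> X -> \bar R) : lsc_pseudometric d ->
  (forall x y, d x y <= mc_d x y) ->
  exists Q (q : mhom X Q), surjective q /\ forall x y, mc_d (q x) (q y) = d x y.
Proof.
move=> pd dle; have [Q [q [cq sq qE]]] :=
  quotient_metCH (@mc_compact R X) (@mc_hausdorff R X) pd.
have nq x y : mc_d (q x) (q y) <= mc_d x y by rewrite qE.
by exists Q, (@MHom R X Q q cq nq).
Qed.

(* The embedding m is a closed map, so X carries the topology induced from Y. *)
Lemma factor_isometric X Y Z (m : mhom X Y) (f : mhom Z Y) : isometric m ->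
  (forall z, exists x, m x = f z) -> exists h : mhom Z X, forall z, m (h z) = f z.
Proof.
move=> im fm; pose h z := sval (cid (fm z)).
have mh z : m (h z) = f z by rewrite /h; case: cid.
have ch : continuous h.
  apply/continuous_closedP => K clK.
  have -> : h @^-1` K = f @^-1` (m @` K).
    apply/seteqP; split => z /=; first by move=> Kz; exists (h z).
    by move=> [x Kx]; rewrite -mh => /(isometric_inj im) <-.
  move/continuous_closedP: (@mfun_cont _ _ _ f); apply.
  by apply: closed_image; [exact: mc_compact|exact: mc_hausdorff|exact: mfun_cont|].
have nh z z' : mc_d (h z) (h z') <= mc_d z z'.
  by rewrite -im !mh mfun_nonexp.
by exists (@MHom R Z X h ch nh).
Qed.

(** If [h] identifies [f] with [g], the metric pulled back along [h] is one of the pseudometrics in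
    the supremum. The last clause is thus the condition under which [factor_surjective] factors [h]
    through [q]. *)
Lemma coequalizer_exists X Y (f g : mhom X Y) : exists Q (q : mhom Y Q),
  [/\ surjective q, forall x, q (f x) = q (g x)
    & forall Z (h : mhom Y Z), (forall x, h (f x) = h (g x)) ->
        forall y y', mc_d (h y) (h y') <= mc_d (q y) (q y')].
Proof.
pose D := [set d : Y -> Y -> \bar R | [/\ lsc_pseudometric d,
  forall y y', d y y' <= mc_d y y' & forall x, d (f x) (g x) = 0]].
pose s y y' := ereal_sup [set d y y' | d in D].
have s_ub d y y' : D d -> d y y' <= s y y'.
  by move=> Dd; apply: ereal_sup_ubound; exists d.
have s_le y y' u : (forall d, D d -> d y y' <= u) -> s y y' <= u.
  by move=> du; apply: ge_ereal_sup => _ [d Dd <-]; exact: du.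
(* The zero pseudometric makes the family nonempty, which keeps the supremum nonnegative. *)
have D0 : D (fun _ _ => 0).
  split => //; last by move=> y y'; exact: mc_d_ge0.
  split => // [x y z|u]; first by rewrite adde0.
  case: (ltP u 0) => u0.
    by rewrite (_ : [set _ | _] = setT); [exact: openT|apply/seteqP].
  by rewrite (_ : [set _ | _] = set0); [exact: open0|apply/seteqP; split].
have s0 y y' : 0 <= s y y' by apply: (s_ub (fun _ _ => 0)).
have ps : lsc_pseudometric s.
  split => //.
  - by move=> x; apply/le_anti; rewrite s0 andbT; apply: s_le => d [[_ -> ]].
  - move=> x y z; apply: s_le => d Dd; have [[_ _ dtri _ _] _ _] := Dd.
    by apply: le_trans (dtri x y z) _; apply: leeD; exact: s_ub.
  - move=> x y; apply/le_anti/andP; split; apply: s_le => d Dd;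
      have [[_ _ _ -> _] _ _] := Dd; exact: s_ub.
  - apply: (lsc_sup (F := fun d (p : Y * Y) => d p.1 p.2)).
    by move=> d [[]].
have [Q [q [sq qE]]] : exists Q (q : mhom Y Q),
    surjective q /\ forall x y, mc_d (q x) (q y) = s x y.
  by apply: quotient_mhom => // y y'; apply: s_le => d [].
exists Q, q; split => //.
- move=> x; apply: mc_d_eq0; rewrite qE; apply: s_le => d [_ _ ->]; exact: lexx.
- move=> Z h hfg y y'; rewrite qE; apply: (s_ub (fun y y' => mc_d (h y) (h y'))).
  split; last by move=> x; rewrite hfg mc_d_refl.
    apply: lsc_pseudometric_comp; first exact: mc_lsc_pseudometric.
    exact: mfun_cont.
  by move=> ? ?; exact: mfun_nonexp.
Qed.

End Morphisms.

(** * Pushouts of isometric maps, and their consequences for monos and epis *)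

Section Amalgamation.
Variable R : realType.
Implicit Types A B C K S Q X Y Z : metCH R.

(** Since the infimum is attained, [d s s'] is either the direct distance or the length of an actual
    detour through [K]. Each axiom becomes a case split on this alternative, which the last clause
    exports. *)
Lemma extend_pseudometric K S (phi : mhom K S) (delta : K -> K -> \bar R) :
  isometric phi -> lsc_pseudometric delta ->
  (forall k k', delta k k' <= mc_d k k') ->
  exists d : S -> S -> \bar R,
  [/\ lsc_pseudometric d, forall s s', d s s' <= mc_d s s',
      forall k k', d (phi k) (phi k') = delta k k'
    & forall s s', d s s' = mc_d s s' \/ exists k k',
        d s s' = mc_d s (phi k) + delta k k' + mc_d (phi k') s'].
Proof.
move=> iphi [delta0 deltaxx deltatri deltasym deltal] delta_le.
pose G (p : S * S) (k : K * K) :=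
  mc_d p.1 (phi k.1) + delta k.1 k.2 + mc_d (phi k.2) p.2.
pose d s s' := mine (mc_d s s') (ereal_inf (range (G (s, s')))).
have cKK : compact [set: (K * K)%type].
  by rewrite -setXTT; apply: compact_setX; exact: mc_compact.
have lG : lsc (fun p : (S * S) * (K * K) => G p.1 p.2).
  have cphi := @mfun_cont _ _ _ phi.
  have c1 := @continuous_fst (S * S)%type (K * K)%type.
  have c2 := @continuous_snd (S * S)%type (K * K)%type.
  have c11 := continuous_compose (@continuous_fst _ _) c1.
  have c12 := continuous_compose (@continuous_snd _ _) c1.
  have c21 := continuous_compose (@continuous_fst _ _) c2.
  have c22 := continuous_compose (@continuous_snd _ _) c2.
  apply: lsc_add => [p|p||]; rewrite ?adde_ge0 ?mc_d_ge0 //.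
    apply: lsc_add => [p|p||]; rewrite ?mc_d_ge0 //.
      apply: (lsc_comp (@mc_d_cont R S) (f := fun p => (p.1.1, phi p.2.1))).
      exact: continuous_pair c11 (continuous_compose cphi c21).
    apply: (lsc_comp deltal (f := fun p => (p.2.1, p.2.2))).
    exact: continuous_pair c21 c22.
  apply: (lsc_comp (@mc_d_cont R S) (f := fun p => (phi p.2.2, p.1.2))).
  exact: continuous_pair (continuous_compose cphi c22) c12.
have d_le s s' : d s s' <= mc_d s s' by rewrite /d ge_min lexx.
have d_leG s s' k k' : d s s' <= mc_d s (phi k) + delta k k' + mc_d (phi k') s'.
  rewrite /d ge_min; apply/orP; right.
  by apply: ereal_inf_lbound; exists (k, k').
have dP s s' : d s s' = mc_d s s' \/ exists k k',
    d s s' = mc_d s (phi k) + delta k k' + mc_d (phi k') s'.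
  rewrite /d; case: leP => [_|Gd]; first by left.
  have lGs : lsc (G (s, s')).
    apply: (lsc_comp lG (f := fun k => ((s, s'), k))).
    by apply: continuous_pair => k; [exact: cvg_cst|exact: cvg_id].
  have [Gy|[[k k'] _ Gk]] := lsc_inf_attained cKK lGs; last by right; exists k, k'.
  by move: Gd; rewrite Gy ltNge leey.
have d_sym s s' : d s s' = d s' s.
  suff h t t' : d t t' <= d t' t by apply/le_anti; rewrite !h.
  have [->|[k [k' ->]]] := dP t' t; first by rewrite mc_d_sym.
  apply: le_trans (d_leG t t' k' k) _.
  rewrite (mc_d_sym t) (deltasym k') (mc_d_sym _ t') [leLHS]addeC.
  by rewrite [X in _ + X <= _]addeC addeA.
have d_ge0 s s' : 0 <= d s s'.
  by have [->|[k [k' ->]]] := dP s s'; rewrite ?adde_ge0 ?mc_d_ge0.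
have d_delta k k' : d (phi k) (phi k') = delta k k'.
  apply/le_anti/andP; split.
    by apply: le_trans (d_leG _ _ k k') _; rewrite !mc_d_refl adde0 add0e.
  have [->|[l [l' ->]]] := dP (phi k) (phi k'); first by rewrite iphi.
  rewrite !iphi; apply: le_trans (deltatri k l' k') _.
  apply: leeD => //; apply: le_trans (deltatri k l l') _; exact: leeD.
exists d; split => //; split => //.
- by move=> s; apply/le_anti; rewrite d_ge0 andbT -(mc_d_refl s).
- move=> x y z; have [->|[k [k' ->]]] := dP x y; have [->|[l [l' ->]]] := dP y z.
  + by apply: le_trans (d_le x z) _; exact: mc_d_tri.
  + apply: le_trans (d_leG x z l l') _; rewrite !addeA.
    by do 2 apply: leeD => //; exact: mc_d_tri.
  + apply: le_trans (d_leG x z k k') _; rewrite -!addeA.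
    by do 2 apply: leeD => //; exact: mc_d_tri.
  + apply: le_trans (d_leG x z k l') _.
    (* Two successive detours merge into one: the stretch from [phi k'] through [y] to [phi l] is at
       least [mc_d k' l], as [phi] is isometric, hence at least [delta k' l]. *)
    have dkl : delta k l' <= delta k k' + (mc_d (phi k') y + mc_d y (phi l)) + delta l l'.
      apply: le_trans (deltatri k l l') _; apply: leeD => //.
      apply: le_trans (deltatri k k' l) _; apply: leeD => //.
      by apply: le_trans (delta_le _ _) _; rewrite -iphi; exact: mc_d_tri.
    apply: (@le_trans _ _ (mc_d x (phi k) + (delta k k' +
        (mc_d (phi k') y + mc_d y (phi l)) + delta l l') + mc_d (phi l') z)).
      by apply: leeD => //; exact: leeD.
    by rewrite !addeA.
- apply: lsc_min; first by exact: mc_d_cont.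
  exact: lsc_inf cKK lG.
Qed.

(** [Q] is the pushout of [m] and [g], built as a quotient of B + C. The third clause says that the
    distance from [B] to [C], when finite, is realised by a path through a point of [A]. *)
Lemma amalgam A B C (m : mhom A B) (g : mhom A C) : isometric m ->
  exists Q (j : mhom B Q) (k : mhom C Q),
  [/\ forall a, j (m a) = k (g a), isometric k,
      forall b c, mc_d (j b) (k c) < +oo ->
        exists a, mc_d b (m a) + mc_d (g a) c <= mc_d (j b) (k c),
      forall q, (exists b, q = j b) \/ (exists c, q = k c)
    & forall Z (u : mhom B Z) (v : mhom C Z), (forall a, u (m a) = v (g a)) ->
        exists h : mhom Q Z, (forall b, h (j b) = u b) /\ (forall c, h (k c) = v c)].
Proof.
move=> im.
have [S [i1 [i2 [surjS ii1 ii2 far copairS]]]] := binary_coproduct B C.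
have [K [a1 [a2 [surjK ia1 ia2 farK copairK]]]] := binary_coproduct A C.
(* [phi] embeds A + C into B + C and [psi] folds A + C onto [C]. Pulling the metric of [C] back
   along [psi] glues [a] to [g a] and leaves distances in [C] unchanged. *)
have [phi [phi1 phi2]] := copairK S (mhom_comp i1 m) i2.
have [psi [psi1 psi2]] := copairK C g (mhom_id C).
have iphi : isometric phi.
  move=> x y; have [[a ->]|[c ->]] := surjK x; have [[a' ->]|[c' ->]] := surjK y;
    rewrite ?phi1 ?phi2 /=.
  - by rewrite ii1 im ia1.
  - by rewrite far farK.
  - by rewrite mc_d_sym far mc_d_sym farK.
  - by rewrite ii2 ia2.
have [d [pd d_le d_phi dP]] := extend_pseudometric iphi
  (lsc_pseudometric_comp (mc_lsc_pseudometric C) (@mfun_cont _ _ _ psi))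
  (mfun_nonexp psi).
have [Q [q [sq qE]]] := quotient_mhom pd d_le.
exists Q, (mhom_comp q i1), (mhom_comp q i2); split => /=.
- move=> a; apply: mc_d_eq0; rewrite qE.
  have := d_phi (a1 a) (a2 (g a)).
  by rewrite phi1 phi2 psi1 psi2 /= mc_d_refl => ->.
- by move=> c c' /=; rewrite qE -phi2 -phi2 d_phi !psi2.
(* Distinct summands are infinitely far apart, so a finite distance comes from a detour entering A +
   C in [A] and leaving it in [C]. *)
- move=> b c; rewrite qE; have [->|[k [k' ->]]] := dP (i1 b) (i2 c).
    by rewrite far ltxx.
  have [[a ->]|[c1 ->]] := surjK k; last first.
    rewrite phi2 far addye ?addye ?ltxx //.
    + by rewrite gt_eqF // (lt_le_trans ltNy0) // mc_d_ge0.
    + by rewrite gt_eqF // (lt_le_trans ltNy0) // mc_d_ge0.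
  have [[a' ->]|[c' ->]] := surjK k'.
    rewrite !phi1 /= far addey ?ltxx //.
    by rewrite gt_eqF // (lt_le_trans ltNy0) // adde_ge0 ?mc_d_ge0.
  rewrite phi1 phi2 psi1 psi2 /= ii1 ii2 => _; exists a.
  by rewrite -addeA; apply: leeD => //; exact: mc_d_tri.
- move=> p; have [s <-] := sq p.
  by have [[b ->]|[c ->]] := surjS s; [left; exists b|right; exists c].
move=> Z u v uv; have [w [w1 w2]] := copairS Z u v.
(* On A + C the map [w] factors through [psi], so it does not expand the middle leg of a detour
   either. *)
have wphi k : w (phi k) = v (psi k).
  have [[a ->]|[c ->]] := surjK k; first by rewrite phi1 psi1 /= w1.
  by rewrite phi2 psi2 w2.
have [h hE] : exists h : mhom Q Z, forall s, h (q s) = w s.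
  apply: factor_surjective => // s s'; rewrite qE.
  have [->|[k [k' ->]]] := dP s s'; first exact: mfun_nonexp.
  apply: le_trans (mc_d_tri _ (w (phi k')) _) _; apply: leeD; last exact: mfun_nonexp.
  apply: le_trans (mc_d_tri _ (w (phi k)) _) _; apply: leeD; first exact: mfun_nonexp.
  by rewrite !wphi mfun_nonexp.
by exists h; split => x; rewrite hE.
Qed.

(** [j] and [k] form the cokernel pair of [m]. If they agree at [b], the distance 0 between [j b]
    and [k b] is realised through some [m a], and then [m a] equals [b]. *)
Lemma isometric_separating A B (m : mhom A B) : isometric m ->
  exists Q (j k : mhom B Q), forall b, j b = k b <-> exists a, m a = b.
Proof.
move=> im; have [Q [j [k [jk _ jk_lt _ _]]]] := amalgam m im.
exists Q, j, k => b; split => [jkb|[a <-] //].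
have [|a] := jk_lt b b; rewrite jkb mc_d_refl ?ltry // => ab.
exists a; apply: mc_d_eq0; apply: le_trans ab.
by rewrite leeDr // mc_d_ge0.
Qed.

(** The image is closed, so its inclusion is isometric and two maps agree exactly on it; an
    epimorphism forces them to be equal. *)
Lemma epi_surjective X Y (f : mhom X Y) :
  (forall Z (u v : mhom Y Z), (forall x, u (f x) = v (f x)) -> u = v) ->
  surjective f.
Proof.
move=> epi_f.
have [S [m [im rm]]] : exists S (m : mhom S Y), isometric m /\ range m = range f.
  apply: closed_subspace; apply: closed_image; [exact: mc_compact
    |exact: mc_hausdorff|exact: mfun_cont|exact: closedT].
have [Q [j [k jk]]] := isometric_separating im.
have jk_eq : j = k.
  apply: epi_f => x; apply/jk.
  have [s _ sx] : range m (f x) by rewrite rm; exists x.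
  by exists s.
move=> y; have [s sy] : exists s, m s = y by apply/jk; rewrite jk_eq.
have [x _ <-] : range f y by rewrite -rm; exists s.
by exists x.
Qed.

(** The metric is separated and lower semicontinuous, so [f] and [g] agree on the closed set where
    their distance is at most 0. *)
Lemma equalizer_exists X Y (f g : mhom X Y) : exists E (m : mhom E X),
  isometric m /\ forall x, f x = g x <-> exists e, m e = x.
Proof.
have cl : closed [set x | f x = g x].
  have -> : [set x | f x = g x] = [set x | mc_d (f x) (g x) <= 0].
    apply/seteqP; split => x /=; last exact: mc_d_eq0.
    by move=> ->; rewrite mc_d_refl.
  apply: lsc_closed_le.
  apply: (lsc_comp (@mc_d_cont R Y) (f := fun x => (f x, g x))).
  by apply: continuous_pair; exact: mfun_cont.
have [E [m [im rm]]] := closed_subspace cl.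
exists E, m; split => // x; split => [fgx|[e <-]].
  have [e _ <-] : range m x by rewrite rm.
  by exists e.
by have : [set x | f x = g x] (m e) by rewrite -rm; exists e.
Qed.

End Amalgamation.

(** * Paths through the equaliser of a coequivalence relation *)

Section CoequivalenceRelation.
Variables (R : realType) (B E : metCH R) (r1 r2 : mhom B E).
Variable diag : mhom E B.
Hypotheses (diag1 : forall b, diag (r1 b) = b) (diag2 : forall b, diag (r2 b) = b).

Let rho x y := mc_d (r1 x) (r2 y).

(* The cotransitivity map E -> E +_B E is non-expansive and the distance in the
   amalgam is an attained infimum. *)
Hypothesis rho_midpoint : forall x y, rho x y < +oo ->
  exists z, rho x z + rho z y <= rho x y.

Let rho_ge x y : mc_d x y <= rho x y.
Proof. by rewrite /rho -{1}(diag1 x) -{1}(diag2 y) mfun_nonexp. Qed.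

Let rho_ge0 x y : 0 <= rho x y. Proof. exact: mc_d_ge0. Qed.

(* Among the pairs (x', y') with d(x, x') + rho(x', y') + d(y', y) <= rho(x, y)
   take one minimising rho. A midpoint z of (x', y') yields two such pairs
   (x', z) and (z, y') whose rho-values add up to at most the minimum, so the
   minimum is 0. *)
Lemma rho_through_equalizer x y : rho x y < +oo ->
  exists a, r1 a = r2 a /\ mc_d x a + mc_d a y <= rho x y.
Proof.
move=> rxy.
pose P (p : B * B) := mc_d x p.1 + rho p.1 p.2 + mc_d p.2 y.
have cr1 := @mfun_cont _ _ _ r1; have cr2 := @mfun_cont _ _ _ r2.
have c1 := @continuous_fst B B; have c2 := @continuous_snd B B.
have cst_cont b : continuous (fun _ : (B * B)%type => b : B).
  by move=> p; exact: cvg_cst.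
have lrho : lsc (fun p : B * B => rho p.1 p.2).
  apply: (lsc_comp (@mc_d_cont R E) (f := fun p => (r1 p.1, r2 p.2))).
  exact: continuous_pair (continuous_compose cr1 c1) (continuous_compose cr2 c2).
have lP : lsc P.
  apply: lsc_add => [p|p||]; rewrite ?adde_ge0 ?mc_d_ge0 //.
    apply: lsc_add => [p|p||//]; rewrite ?mc_d_ge0 //.
    apply: (lsc_comp (@mc_d_cont R B) (f := fun p => (x, p.1))).
    exact: continuous_pair.
  apply: (lsc_comp (@mc_d_cont R B) (f := fun p => (p.2, y))).
  exact: continuous_pair.
pose S := [set p | P p <= rho x y].
have cS : compact S.
  have cBB := compact_setX (@mc_compact R B) (@mc_compact R B).
  exact: subclosed_compact (lsc_closed_le lP) cBB _.
have minS p : S p -> ereal_inf ((fun p : B * B => rho p.1 p.2) @` S) <= rho p.1 p.2.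
  by move=> Sp; apply: ereal_inf_lbound; exists p.
have Sxy : S (x, y) by rewrite /S /P /= !mc_d_refl add0e adde0.
have [infy|[[x' y'] Sxy' infE]] := lsc_inf_attained cS lrho.
  by have := le_lt_trans (minS _ Sxy) rxy; rewrite infy.
rewrite infE /= in minS.
have rxy' : rho x' y' < +oo by apply: le_lt_trans rxy; exact: (minS (x, y)).
have [z rz] := rho_midpoint rxy'.
have Sxz : S (x', z).
  apply: le_trans Sxy'; rewrite /P /= -!addeA; apply: leeD => //.
  apply: (@le_trans _ _ (rho x' z + (rho z y' + mc_d y' y))).
    apply: leeD => //; apply: le_trans (mc_d_tri z y' y) _; exact: leeD.
  by rewrite addeA; exact: leeD.
have Szy : S (z, y').
  apply: le_trans Sxy'; rewrite /P /=; apply: leeD => //.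
  apply: (@le_trans _ _ ((mc_d x x' + rho x' z) + rho z y')).
    apply: leeD => //; apply: le_trans (mc_d_tri x x' z) _; exact: leeD.
  by rewrite -addeA; exact: leeD.
have r0 : rho x' y' <= 0.
  have := le_trans (leeD (minS _ Sxz) (minS _ Szy)) rz.
  move: rxy' (rho_ge0 x' y'); rewrite /=; case: (rho x' y') => // v _ _.
  by rewrite -EFinD !lee_fin gerDl.
have r12 : r1 x' = r2 y' := mc_d_eq0 r0.
have xy' : x' = y' by apply: mc_d_eq0; exact: le_trans (rho_ge _ _) r0.
subst y'; exists x'; split => //.
by apply: le_trans Sxy'; rewrite /P /= leeD // leeDl.
Qed.

(** The copairing of [u] and [v] descends along the surjection B + B -> E once it is bounded by the
    metric of [E]. Within one copy of [B] the retraction gives the bound; across copies a path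
    through the equaliser does, as [u] and [v] agree there. *)
Lemma coequivalence_cokernel_pair (A : metCH R) (m : mhom A B) :
  (forall e, (exists x, e = r1 x) \/ (exists x, e = r2 x)) ->
  (forall b, r1 b = r2 b -> exists a, m a = b) ->
  forall (Z : metCH R) (u v : mhom B Z), (forall a, u (m a) = v (m a)) ->
  exists h : mhom E Z, (forall b, h (r1 b) = u b) /\ (forall b, h (r2 b) = v b).
Proof.
move=> surjE eqm Z u v uv.
have [S [i1 [i2 [surjS _ _ _ copair]]]] := binary_coproduct B B.
have [q [q1 q2]] := copair E r1 r2; have [w [w1 w2]] := copair Z u v.
have cross x y : mc_d (u x) (v y) <= rho x y.
  have [rxy|] := ltP (rho x y) +oo; last by rewrite leye_eq => /eqP ->; rewrite leey.
  have [b [/eqm [a <-]]] := rho_through_equalizer rxy; apply: le_trans.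
  apply: le_trans (mc_d_tri _ (u (m a)) _) _; apply: leeD; first exact: mfun_nonexp.
  by rewrite uv mfun_nonexp.
have [h hE] : exists h : mhom E Z, forall s, h (q s) = w s.
  apply: factor_surjective.
    by move=> e; have [[x ->]|[x ->]] := surjE e; [exists (i1 x)|exists (i2 x)].
  move=> s s'; have [[x ->]|[x ->]] := surjS s; have [[y ->]|[y ->]] := surjS s';
    rewrite ?q1 ?q2 ?w1 ?w2.
  - apply: le_trans (mfun_nonexp u _ _) _.
    by rewrite -{1}(diag1 x) -{1}(diag1 y) mfun_nonexp.
  - exact: cross.
  - by rewrite mc_d_sym [leRHS]mc_d_sym; exact: cross.
  - apply: le_trans (mfun_nonexp v _ _) _.
    by rewrite -{1}(diag2 x) -{1}(diag2 y) mfun_nonexp.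
by exists h; split => b; rewrite -?q1 -?q2 hE.
Qed.

End CoequivalenceRelation.

(** * The exactness properties, read in the opposite category *)

Section Coexactness.
Variable R : realType.
Local Notation C := (MetCH_sep_sym R).

Lemma mhom_comp_eq (X Y Z : metCH R) (f f' : mhom X Y) (g g' : mhom Y Z) :
  mhom_comp g f = mhom_comp g' f' <-> forall x, g (f x) = g' (f' x).
Proof. by split=> [gf x|gf]; [exact: (mhom_eqE gf x)|exact: mhom_ext]. Qed.

Lemma mhom_comp_eq1 (X Y Z : metCH R) (f : mhom X Y) (g : mhom Y Z) (h : mhom X Z) :
  mhom_comp g f = h <-> forall x, g (f x) = h x.
Proof. by split=> [<- //|gf]; exact: mhom_ext. Qed.

Lemma op_finitely_complete : finitely_complete (op C).
Proof.
split; last split.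
(* The coproduct of the empty family is the empty space, initial here and so terminal in the
   opposite category. *)
- have [S [inj [surjS _ _ copair]]] :=
    finite_coproduct (fun i : void => of_void (metCH R) i).
  have no_pt (s : S) : False by have [i _] := surjS s; case: i.
  exists S => X.
  have [h _] := copair X (fun i : void => match i with end).
  by exists h => g; apply: mhom_ext => s; case: (no_pt s).
- move=> X Y; have [S [i1 [i2 [surjS _ _ _ copair]]]] := binary_coproduct X Y.
  exists S, i1, i2 => Z f g; have [h [h1 h2]] := copair Z f g.
  exists h; split; first by split; apply: mhom_ext.
  move=> h' [/mhom_comp_eq1 e1 /mhom_comp_eq1 e2]; apply: mhom_ext => s.
  by have [[x ->]|[y ->]] := surjS s; rewrite ?h1 ?h2.
- move=> Y X f g; have [Q [q [sq qfg q_univ]]] := coequalizer_exists f g.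
  exists Q, q; split; first exact: mhom_ext.
  move=> Z h /mhom_comp_eq hfg; have [u uE] := factor_surjective sq (q_univ _ _ hfg).
  exists u; split; first exact: mhom_ext.
  by move=> u' /mhom_comp_eq1 e; apply: mhom_ext => p; have [x <-] := sq p; rewrite uE.
Qed.

(** Before passing to the opposite, this is an equaliser diagram: a map equalising [f] and [g] lands
    in the image of [m] and lifts through it. *)
Lemma isometric_equalizes (E X Y : metCH R) (m : mhom E X) (f g : mhom X Y) :
  isometric m -> (forall x, f x = g x <-> exists e, m e = x) ->
  @is_coequalizer (op C) Y X E f g m.
Proof.
move=> im fg; split; first by apply: mhom_ext => e; apply/fg; exists e.
move=> Z h /mhom_comp_eq hfg.
have [u uE] := factor_isometric im (fun z => (fg (h z)).1 (hfg z)).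
exists u; split; first exact: mhom_ext.
move=> u' /mhom_comp_eq1 e; apply: mhom_ext => z.
by apply: (isometric_inj im); rewrite uE.
Qed.

(** An equaliser [m] of [f] and [g] is compared with the isometric equaliser [e], which transfers
    the isometry to [m]. Conversely, an isometric map is the equaliser of its cokernel pair. *)
Lemma op_regular_epiP (X Y : metCH R) (m : mhom X Y) :
  @regular_epi (op C) Y X m <-> isometric m.
Proof.
split.
  move=> [Z [f [g [/mhom_comp_eq fg univ]]]].
  have [E [e [ie eE]]] := equalizer_exists f g.
  have [|u [/mhom_comp_eq1 mu _]] := univ E e.
    by apply: mhom_ext => x; apply/eE; exists x.
  have [h hE] := factor_isometric ie (fun x => (eE (m x)).1 (fg x)).
  (* Both composites with [m] give [m], so uniqueness makes [u] a retraction of [h]. *)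
  have hK : mhom_comp u h = mhom_id X.
    have [|w [_ w_uniq]] := univ X m; first exact: mhom_ext.
    rewrite -(w_uniq (mhom_comp u h)); last by apply: mhom_ext => x /=; rewrite mu.
    by apply: w_uniq; exact: mhom_ext.
  have uh x : u (h x) = x := mhom_eqE hK x.
  move=> x y; apply/le_anti; rewrite mfun_nonexp /= -{1}(uh x) -{1}(uh y).
  by apply: le_trans (mfun_nonexp u _ _) _; rewrite -ie !hE.
move=> im; have [Q [j [k jk]]] := isometric_separating im.
by exists Q, j, k; exact: isometric_equalizes.
Qed.

Lemma op_coequalizers : has_coequalizers_of_kernel_pairs (op C).
Proof.
move=> X Y P f r1 r2 _; have [E [m [im mE]]] := equalizer_exists r1 r2.
by exists E, m; exact: isometric_equalizes.
Qed.

(** The universal property maps the given pushout to the amalgam by a non-expansive [h] with [h]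
    after [p2] equal to the isometric [k], so [p2] cannot shrink distances. *)
Lemma op_regular_epis_pullback_stable : regular_epis_pullback_stable (op C).
Proof.
move=> B X A P f g p1 p2 [_ univ] /op_regular_epiP fi; apply/op_regular_epiP.
have [Q [j [k [jk ik _ _ _]]]] := amalgam g fi.
have [|h [[_ /mhom_comp_eq1 hk] _]] := univ Q j k; first exact: mhom_ext.
move=> x y; apply/le_anti; rewrite mfun_nonexp /= -ik -!hk.
exact: mfun_nonexp.
Qed.

(** Reflexivity supplies the common retraction [d], transitivity the midpoints, and joint monicity
    the covering of [E] by the images of [r1] and [r2]. *)
Lemma op_effective (B E : metCH R) (r1 r2 : mhom B E) :
  @internal_equivalence_relation (op C) B E r1 r2 -> @effective (op C) B E r1 r2.
Proof.
move=> [jm [d [/mhom_comp_eq1 d1 /mhom_comp_eq1 d2]] _ trans].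
have {}d1 b : d (r1 b) = b := d1 b; have {}d2 b : d (r2 b) = b := d2 b.
have ir2 : isometric r2.
  move=> x y; apply/le_anti; rewrite mfun_nonexp /=.
  by rewrite -{1}(d2 x) -{1}(d2 y) mfun_nonexp.
have midpoint x y : mc_d (r1 x) (r2 y) < +oo -> exists z,
    mc_d (r1 x) (r2 z) + mc_d (r1 z) (r2 y) <= mc_d (r1 x) (r2 y).
  have [Q [j [k [jk _ jk_lt surjQ univ]]]] := amalgam r1 ir2.
  (* The amalgam is the pushout required by transitivity. The resulting [t] sends [r1 x] to
     [j (r1 x)] and [r2 y] to [k (r2 y)] without expanding distances, and the midpoint [z] is the
     point realising their distance in [Q]. *)
  have [|t [/mhom_comp_eq t1 /mhom_comp_eq t2]] := trans Q j k.
    split; first exact: mhom_ext.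
    move=> Z u v /mhom_comp_eq uv; have [h [hj hk]] := univ Z u v uv.
    exists h; split; first by split; exact: mhom_ext.
    move=> h' [/mhom_comp_eq1 e1 /mhom_comp_eq1 e2]; apply: mhom_ext => q.
    by have [[b ->]|[c ->]] := surjQ q; rewrite ?hj ?hk.
  have tE : mc_d (j (r1 x)) (k (r2 y)) <= mc_d (r1 x) (r2 y).
    by rewrite -t1 -t2 mfun_nonexp.
  move=> rxy; have [z zE] := jk_lt _ _ (le_lt_trans tE rxy).
  by exists z; exact: le_trans tE.
have surjE e : (exists x, e = r1 x) \/ (exists x, e = r2 x).
  have [S [i1 [i2 [surjS _ _ _ copair]]]] := binary_coproduct B B.
  have [q [q1 q2]] := copair E r1 r2.
  (* Joint monicity in the opposite category says that the copairing [q] of [r1] and [r2] is an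
     epimorphism, hence surjective. *)
  have [|s <-] := @epi_surjective _ _ _ q _ e.
    move=> Z u v uv; apply: jm; apply: mhom_ext => b /=.
      by rewrite -q1 uv.
    by rewrite -q2 uv.
  by have [[x ->]|[x ->]] := surjS s; [left|right]; exists x; rewrite ?q1 ?q2.
have [A [m [_ mE]]] := equalizer_exists r1 r2.
exists A, m; split; first by apply: mhom_ext => a; apply/mE; exists a.
move=> Z u v /mhom_comp_eq uv.
have [h [h1 h2]] := coequivalence_cokernel_pair d1 d2 midpoint surjE
  (fun b => (mE b).1) uv.
exists h; split; first by split; exact: mhom_ext.
move=> h' [/mhom_comp_eq1 e1 /mhom_comp_eq1 e2]; apply: mhom_ext => e.
by have [[b ->]|[b ->]] := surjE e; rewrite ?h1 ?h2.
Qed.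

End Coexactness.

Theorem theorem6p1 (R : realType) : barr_coexact (MetCH_sep_sym R).
Proof.
split; last by move=> B E r1 r2; exact: op_effective.
split; [exact: op_finitely_complete|exact: op_coequalizers
  |exact: op_regular_epis_pullback_stable].
Qed.
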